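(* Let $\xi:\mathbb{R}^q\to\mathbb{R}$ be a kernel satisfying conditions (i)-(iii) of the context. Then there exists a constant $L>0$, depending only on $\xi$, such that the following holds. Let $f\in L^1(\mathbb{R}^q)$, let $(\Omega,\mathcal{C},\mathbb{P})$ be a probability space, and let $(\omega,x)\mapsto\varepsilon_\omega(x)$ be a random perturbation (a jointly measurable real-valued function on $\Omega\times\mathbb{R}^q$) satisfying $$\sup_{\omega\in\Omega}\int_{\mathbb{R}^q}|\varepsilon_\omega(x)|\,dx<\infty.$$ Let $\mathfrak{P}_n^\omega(f)$ denote the probabilistic sampling Kantorovich operator with kernel $\xi$ and perturbation $\varepsilon_\omega$, as defined in the context. Then for all integers $n\ge 1$, $$\mathbb{E}\left[\|\mathfrak{P}_n^\omega(f)\|_{L^1(\mathbb{R}^q)}\right]\le L\left(\|f\|_{L^1(\mathbb{R}^q)}+\mathbb{E}\left[\|\varepsilon_\omega\|_{L^1(\mathbb{R}^q)}\right]\right).$$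
   Context: Let $q\ge 1$ be an integer. The kernel is a measurable function $\xi:\mathbb{R}^q\to\mathbb{R}$ such that: (i) $\sum_{k\in\mathbb{Z}^q}\xi(x-k)=1$ for all $x\in\mathbb{R}^q$; (ii) $\sup_{x\in\mathbb{R}^q}|\xi(x)|<\infty$; (iii) there exist $\delta>0$ and $C>0$ such that $|\xi(x)|\le C(1+\|x\|)^{-q-\delta}$ for all $x\in\mathbb{R}^q$. For $n\in\mathbb{N}$, $n\ge1$, and $k=(k_1,\dots,k_q)\in\mathbb{Z}^q$ put $R_k^n=\prod_{j=1}^q\left[\frac{k_j}{n},\frac{k_j+1}{n}\right)$. For $g\in L^1(\mathbb{R}^q)$ the classical sampling Kantorovich operator is $$\mathfrak{S}_n(g)(x)=n^q\sum_{k\in\mathbb{Z}^q}\xi(nx-k)\int_{R_k^n}g(u)\,du,\qquad x\in\mathbb{R}^q.$$ Given $f\in L^1(\mathbb{R}^q)$ and a random perturbation $\varepsilon_\omega$, $\omega\in\Omega$, the noisy function is $f_\omega(x)=f(x)+\varepsilon_\omega(x)$, and the probabilistic sampling Kantorovich (PSK) operator is $$\mathfrak{P}_n^\omega(f)(x)=\mathfrak{S}_n(f_\omega)(x).$$ $\mathbb{E}$ denotes expectation with respect to $\mathbb{P}$ (integration over $\omega$). The perturbation is the same for all $n$. *)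

(* Defs.v *)
From HB Require Import structures.
From mathcomp Require Import all_boot all_order all_algebra.
From mathcomp Require Import all_classical all_reals all_analysis.

Set Implicit Arguments.
Unset Strict Implicit.
Unset Printing Implicit Defensive.
Import Order.TTheory GRing.Theory Num.Theory.
Import numFieldNormedType.Exports.
Local Open Scope classical_set_scope.
Local Open Scope ring_scope.

(* R^q, with the product of the Borel sigma-algebras, i.e. the Borel
   sigma-algebra of R^q. *)
Notation Rn R q := (q.-tuple (measurableTypeR R)).

Section lebesgue_Rn.
Variable R : realType.

Definition consRn n (p : measurableTypeR R * Rn R n) : Rn R n.+1 :=
  [tuple of p.1 :: p.2].

Lemma measurable_consRn n : measurable_fun [set: _ * _] (@consRn n).
Proof. exact: measurable_cons. Qed.

Section step.
Variables (n : nat) (m : {sigma_finite_measure set (Rn R n) -> \bar R}).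

Definition lebesgue_step : set (Rn R n.+1) -> \bar R :=
  pushforward (@lebesgue_measure R \x m)%E (@consRn n).

Let step0 : lebesgue_step set0 = 0%E.
Proof. by rewrite /lebesgue_step /pushforward preimage_set0 measure0. Qed.

Let step_ge0 A : (0 <= lebesgue_step A)%E.
Proof. by rewrite /lebesgue_step /pushforward measure_ge0. Qed.

Let step_sigma_additive : semi_sigma_additive lebesgue_step.
Proof.
apply: (@measure_semi_sigma_additive _ _ _
  (measure_function_pushforward__canonical__measure_function_Measure _ _)).
exact: measurable_consRn.
Qed.

HB.instance Definition _ := isMeasure.Build _ _ _ lebesgue_step
  step0 step_ge0 step_sigma_additive.

Let step_sigma_finite : sigma_finite setT lebesgue_step.
Proof.
have /sigma_finiteP[F [TF ndF Foo]] := sigma_finiteT (@lebesgue_measure R).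
have /sigma_finiteP[G [TG ndG Goo]] := sigma_finiteT m.
pose g (x : Rn R n.+1) : measurableTypeR R * Rn R n :=
  (thead x, [tuple of behead x]).
have gK : cancel (@consRn n) g.
  by move=> [a t]; rewrite /g theadE; congr pair; apply: val_inj.
have mg : measurable_fun setT g.
  apply/measurable_fun_pairP; split; first exact: measurable_tnth.
  exact: measurable_behead.
exists (fun k => g @^-1` (F k `*` G k)).
  rewrite -preimage_bigcup (_ : \bigcup_k _ = setT) ?preimage_setT//.
  rewrite -subTset => -[x y] _.
  have [i _ Fix] : (\bigcup_k F k) x by rewrite -TF.
  have [j _ Gjy] : (\bigcup_k G k) y by rewrite -TG.
  exists (maxn i j) => //; split => /=.
    by move: x Fix; exact/subsetPset/ndF/leq_maxl.
  by move: y Gjy; exact/subsetPset/ndG/leq_maxr.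
move=> k; have [mF Fk] := Foo k; have [mG Gk] := Goo k; split.
  by rewrite -[X in measurable X]setTI; apply: mg => //; exact: measurableX.
rewrite /lebesgue_step /pushforward -comp_preimage.
rewrite (_ : g \o _ = id); last exact/funext.
by rewrite preimage_id product_measure1E// lte_mul_pinfty// ge0_fin_numE.
Qed.

HB.instance Definition _ := Measure_isSigmaFinite.Build _ _ _ lebesgue_step
  step_sigma_finite.

End step.

(* Lebesgue measure on R^n, as the n-fold product of that on R; its values on
   rectangles (lebesgue_Rn_rect below) characterize it. *)
Fixpoint lebesgue_Rn (n : nat) : {sigma_finite_measure set (Rn R n) -> \bar R} :=
  match n with
  | 0 => @dirac _ _ [tuple] R
  | n'.+1 => lebesgue_step (lebesgue_Rn n')
  end.

Lemma measurable_rect n (A : 'I_n -> set (measurableTypeR R)) :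
  (forall i, measurable (A i)) ->
  measurable ([set x | forall i, A i (tnth x i)] : set (Rn R n)).
Proof.
move=> mA; rewrite (_ : mkset _ = \bigcap_i (fun x => tnth x i) @^-1` A i).
  apply: fin_bigcap_measurable => [|i _]; first exact: finite_finset.
  by rewrite -[X in measurable X]setTI; apply: (measurable_tnth i).
by apply/seteqP; split => x /= Ax i; [move=> _|]; exact: Ax.
Qed.

Lemma lebesgue_Rn_rect n (A : 'I_n -> set (measurableTypeR R)) :
  (forall i, measurable (A i)) ->
  lebesgue_Rn n [set x | forall i, A i (tnth x i)] =
  (\prod_(i < n) lebesgue_measure (A i))%E.
Proof.
elim: n A => [|n IHn] A mA.
  by rewrite big_ord0 /= diracE mem_set// => -[].
rewrite big_ord_recl -IHn//= /lebesgue_step /pushforward.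
rewrite -product_measure1E//; last exact: (measurable_rect (fun i => mA (lift ord0 i))).
congr (_ \x _)%E; apply/seteqP; split => [[a t] /= At|[a t] /= [Aa At] i].
  split; first exact: (At ord0).
  by move=> i; have := At (lift ord0 i); rewrite tnthS.
by case: (unliftP ord0 i) => [j ->|->//]; rewrite tnthS; exact: At.
Qed.

End lebesgue_Rn.

(* Unconditional sum.  Under the convention +oo - +oo = -oo of \bar R, the sum
   is finite if and only if the family is absolutely summable. *)
Definition usum (R : realType) (I : choiceType) (a : I -> \bar R) : \bar R :=
  (\esum_(i in [set: I]) a^\+ i - \esum_(i in [set: I]) a^\- i)%E.

Section sampling_Kantorovich.
Variables (R : realType) (q : nat).

Definition enorm (x : Rn R q) : R := Num.sqrt (\sum_(j < q) tnth x j ^+ 2).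

Definition subZn (x : Rn R q) (k : q.-tuple int) : Rn R q :=
  [tuple tnth x j - (tnth k j)%:~R | j < q].

Definition dilate (n : nat) (x : Rn R q) : Rn R q :=
  [tuple n%:R * tnth x j | j < q].

Record is_kernel (xi : Rn R q -> R) : Prop := IsKernel {
  kernel_measurable : measurable_fun [set: Rn R q] xi ;
  kernel_sum1 : forall x, usum (fun k => (xi (subZn x k))%:E) = 1%E ;
  kernel_bounded : (ereal_sup (range (fun x => `|xi x|%:E)) < +oo)%E ;
  kernel_decay : exists delta C : R, [/\ 0 < delta, 0 < C &
    forall x, `|xi x| <= C * (1 + enorm x) `^ (- q%:R - delta)] }.

Definition cell (n : nat) (k : q.-tuple int) : set (Rn R q) :=
  [set x | forall j, (tnth k j)%:~R / n%:R <= tnth x j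
                     < ((tnth k j)%:~R + 1) / n%:R].

(* Values are kept in \bar R, so that no divergent sum or integral is silently
   replaced by a finite number. *)
Definition sampling_Kantorovich (xi : Rn R q -> R) (n : nat) (g : Rn R q -> R)
    (x : Rn R q) : \bar R :=
  ((n%:R ^+ q)%:E * usum (fun k => (xi (subZn (dilate n x) k))%:E *
     \int[lebesgue_Rn R q]_(u in cell n k) (g u)%:E))%E.

Definition PSK (Omega : Type) (xi : Rn R q -> R) (eps : Omega -> Rn R q -> R)
    (n : nat) (w : Omega) (f : Rn R q -> R) : Rn R q -> \bar R :=
  sampling_Kantorovich xi n (f \+ eps w).

End sampling_Kantorovich.

(* Main.v *)
Require Import Defs.
From mathcomp Require Import all_boot all_order all_algebra.
From mathcomp Require Import all_classical all_reals all_analysis.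
From mathcomp Require Import measurable_realfun.
From mathcomp Require Import ring.

Set Implicit Arguments.
Unset Strict Implicit.
Unset Printing Implicit Defensive.
Import Order.TTheory GRing.Theory Num.Theory.
Import numFieldNormedType.Exports.
Local Open Scope classical_set_scope.
Local Open Scope ring_scope.

(** The bound holds with [L = |xi|_1 + 1], where [|.|_1] is the [L^1] norm; the
    summand [1] only makes [L] positive.

    For each [w] the operator is bounded on [L^1]: by the triangle inequality
    [|S_n g (x)| <= n^q \sum_k |xi (n x - k)| \int_(R_k^n) |g|].  Integrate in
    [x] and exchange sum and integral by Tonelli.  The change of variables
    [y = n x - k] turns each [\int |xi (n x - k)| dx] into [n^-q |xi|_1], which
    cancels [n^q], and the cells [R_k^n] are disjoint, so that
    [\sum_k \int_(R_k^n) |g| <= |g|_1]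
    ([ge0_integral_subZn_dilate], [esum_integral_cell_le],
    [sampling_Kantorovich_L1_le]).  Apply this to [g = f + eps w], use the
    triangle inequality for [|.|_1] and integrate in [w].

    The constant is finite because the decay of [xi] is dominated by a function
    with separated variables: with [s = (q + delta) / q > 1],
    [(1 + |x|)^(- q - delta) <= \prod_j (1 + |x_j|)^(- s)], whose integral is
    the [q]-th power of [\int (1 + |t|)^(- s) dt = 2 / (s - 1)]
    ([decay_le_prod], [ge0_integral_prod_Rn], [integral_decay1]).

    Integrals on [R^q] are reduced to dimension one by induction on [q], through
    Tonelli's theorem for the first coordinate ([ge0_integral_RnS]). *)

(** * Monotonicity of the integral without measurability *)

(** The integral of a nonnegative function is a supremum over the simple
    functions below it, so it is monotone on all of them.  This bounds the integral
    of [sampling_Kantorovich xi n g], and that of its norm as a function of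
    [w], through measurable majorants alone. *)
Lemma ge0_le_integral_nonmeasurable d (T : measurableType d) (R : realType)
    (mu : {measure set T -> \bar R}) (f g : T -> \bar R) :
  (forall x, 0 <= f x)%E -> (forall x, f x <= g x)%E ->
  (\int[mu]_x f x <= \int[mu]_x g x)%E.
Proof.
move=> f0 fg; have g0 x : (0 <= g x)%E by exact: le_trans (fg x).
rewrite !ge0_integralTE//; apply: le_ereal_sup => _ [h hf <-].
by exists h => // x; exact: le_trans (fg x).
Qed.

(** * Sums over a countable type *)

Section esum_countable.
Local Open Scope ereal_scope.
Context {R : realType} {I : countType}.

(** An enumeration of [I] gives access to the theory of series, in particular
    to the exchange of a series and an integral. *)
Lemma esum_countE (a : I -> \bar R) : (forall i, 0 <= a i) ->
  \esum_(i in [set: I]) a i = \sum_(n <oo) oapp a 0 (pickle_inv n).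
Proof.
move=> a0; have b0 n : 0 <= oapp a 0 (@pickle_inv I n).
  by case: pickle_inv => /=.
have pI : set_inj [set: I] pickle by move=> i j _ _; exact: (pcan_inj pickleK).
rewrite nneseries_esumT//.
transitivity (\esum_(n in pickle @` [set: I]) oapp a 0 (@pickle_inv I n)).
  by rewrite esum_image//; apply: eq_esum => i _; rewrite pickleK_inv.
rewrite esum_mkcond; apply: eq_esum => n _; case: ifPn => //.
case E : (pickle_inv n) => [i|//]; rewrite notin_setE => -[]; exists i => //.
by have := @pickle_invK I n; rewrite E.
Qed.

Lemma esumZl (c : R) (a : I -> \bar R) : (0 <= c)%R -> (forall i, 0 <= a i) ->
  \esum_(i in [set: I]) (c%:E * a i) = c%:E * \esum_(i in [set: I]) a i.
Proof.
move=> c0 a0; rewrite !esum_countE//; last by move=> i; rewrite mule_ge0.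
rewrite -nneseriesZl; last by move=> n _; case: pickle_inv => /=.
by apply: eq_eseriesr => n _; case: pickle_inv => //=; rewrite mule0.
Qed.

Lemma ge0_integral_esum d (T : measurableType d)
    (mu : {measure set T -> \bar R}) (f : I -> T -> \bar R) :
  (forall i, measurable_fun [set: T] (f i)) -> (forall i x, 0 <= f i x) ->
  \int[mu]_x (\esum_(i in [set: I]) f i x) =
  \esum_(i in [set: I]) \int[mu]_x f i x.
Proof.
move=> mf f0; rewrite esum_countE; last by move=> i; exact: integral_ge0.
under eq_integral do rewrite esum_countE//.
rewrite integral_nneseries//; last 2 first.
- by move=> n; case: pickle_inv => [i|] /=; [exact: mf|exact: measurable_cst].
- by move=> n x _; case: pickle_inv => /=.
apply: eq_eseriesr => n _; case: pickle_inv => [i|] //=.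
exact: integral0.
Qed.

(** Under the convention [+oo - +oo = -oo] this includes the divergent case, in
    which both sides are [+oo]. *)
Lemma abse_usum_le (a : I -> \bar R) :
  `|usum a| <= \esum_(i in [set: I]) `|a i|.
Proof.
have -> : \esum_(i in [set: I]) `|a i| = \esum_(i in [set: I]) (a^\+ i + a^\- i).
  by apply: eq_esum => i _; rewrite -[LHS]/((abse \o a) i) fune_abse.
rewrite /usum esumD//; apply: (le_trans (lee_abs_sub _ _)).
by rewrite !gee0_abs// esum_ge0.
Qed.

(** At most one term is nonzero. *)
Lemma esum_indic_disjoint_le T (D : I -> set T) (x : T) (c : \bar R) :
  (forall i j, D i x -> D j x -> i = j) -> 0 <= c ->
  \esum_(i in [set: I]) (if x \in D i then c else 0) <= c.
Proof.
move=> D1 c0.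
have [[i Di]|noD] := pselect (exists i, D i x).
  rewrite -[leRHS](@esum_set1 _ _ i (fun=> c))//.
  rewrite [leRHS]esum_mkcond; apply: le_esum => j _.
  rewrite le_eqVlt; apply/orP; left; apply/eqP.
  congr (if _ then _ else _); apply/idP/idP; rewrite !inE.
    by move=> Dj; exact: D1.
  by move=> ->.
rewrite esum1// => i _; case: ifPn => //; rewrite inE => Di.
by case: noD; exists i.
Qed.

End esum_countable.

(** * Integration against Lebesgue measure on R and on R^q *)

Section lebesgue_Rn_integral.
Context {R : realType}.
Local Open Scope ereal_scope.
Local Notation mu := (@lebesgue_measure R).

Lemma ge0_integral_RnS n (f : Rn R n.+1 -> \bar R) :
  measurable_fun setT f -> (forall x, 0 <= f x) ->
  \int[lebesgue_Rn R n.+1]_x f x =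
  \int[mu]_a \int[lebesgue_Rn R n]_t f (consRn (a, t)).
Proof.
move=> mf f0.
transitivity (\int[pushforward (mu \x lebesgue_Rn R n) (@consRn R n)]_x f x).
  by [].
rewrite ge0_integral_pushforward//; last exact: measurable_consRn.
rewrite preimage_setT fubini_tonelli1//; last by move=> x; exact: f0.
by apply: measurableT_comp => //; exact: measurable_consRn.
Qed.

Lemma measurable_integral_cons n (f : Rn R n.+1 -> \bar R) :
  measurable_fun setT f -> (forall x, 0 <= f x) ->
  measurable_fun setT (fun a => \int[lebesgue_Rn R n]_t f (consRn (a, t))).
Proof.
move=> mf f0; apply: (@measurable_fun_fubini_tonelli_F _ _ _ _ R
  (lebesgue_Rn R n) (f \o @consRn R n)); last by move=> x; exact: f0.
by apply: measurableT_comp => //; exact: measurable_consRn.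
Qed.

Lemma measurable_affine (c b : R) :
  measurable_fun setT
    (fun x : measurableTypeR R => (c * x - b)%R : measurableTypeR R).
Proof.
by apply: measurable_funB => //; exact: measurable_funM.
Qed.

(** Lebesgue measure is determined by its values on half-open intervals, and
    [c] times its image under [x |-> c x - b] has the same values there. *)
Lemma ge0_integral_affine (c b : R) (f : measurableTypeR R -> \bar R) : (0 < c)%R ->
  measurable_fun setT f -> (forall x, 0 <= f x) ->
  \int[mu]_x f (c * x - b)%R = c^-1%:E * \int[mu]_x f x.
Proof.
move=> c0 mf f0.
pose phi (x : measurableTypeR R) : measurableTypeR R := (c * x - b)%R.
have mphi : measurable_fun setT phi by exact: measurable_affine.
pose ci : {nonneg R} := NngNum (ltW (c0 : 0 < c)%R).
pose PM := (measure_function_pushforward__canonical__measure_function_Measure mu mphi).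
have E (A : set (measurableTypeR R)) : measurable A -> mu A = mscale ci PM A.
  apply: lebesgue_measure_unique => _ [[u v]] _ <-.
  rewrite -[RHS]/(c%:E * mu (phi @^-1` `]u, v]%classic)).
  rewrite (_ : phi @^-1` _ = `](u + b) / c, (v + b) / c]%classic)%R; last first.
    apply/seteqP; split => x /=; rewrite !in_itv/= /phi ltrBrDr lerBlDr;
    by rewrite ltr_pdivrMr// ler_pdivlMr// [(c * x)%R]mulrC.
  rewrite !lebesgue_measure_itv/= !lte_fin ltr_pM2r ?invr_gt0// ltrD2r.
  case: ifPn => _; rewrite ?mule0// -!EFinD -EFinM; congr (_%:E).
  by field; rewrite gt_eqF.
have -> : \int[mu]_x f x = c%:E * \int[PM]_x f x.
  rewrite -[c%:E]/(ci%:num%:E) -ge0_integral_mscale//.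
  by apply: eq_measure_integral => A mA _; exact: E.
rewrite muleA -EFinM mulVf ?gt_eqF// mul1e.
by rewrite ge0_integral_pushforward.
Qed.

Lemma measurable_subZn_dilate q n (k : q.-tuple int) :
  measurable_fun setT (fun x : Rn R q => subZn (dilate n x) k).
Proof.
apply/measurable_fun_tnthP => j.
rewrite (_ : _ \o _ = (fun x : Rn R q => n%:R * tnth x j - (tnth k j)%:~R)%R).
  apply: (measurableT_comp (measurable_affine _ _)); exact: measurable_tnth.
by apply/funext => x; rewrite /= !tnth_mktuple.
Qed.

Lemma subZn_dilate_cons q n (k : q.+1.-tuple int) (a : R) (t : Rn R q) :
  subZn (dilate n (consRn (a, t))) k =
  consRn ((n%:R * a - (thead k)%:~R)%R,
          subZn (dilate n t) [tuple of behead k]).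
Proof.
apply: eq_from_tnth => j; rewrite !tnth_mktuple.
case: (unliftP ord0 j) => [i ->|->]; last by rewrite /thead.
by rewrite !tnthS !tnth_mktuple {1}(tuple_eta k) tnthS.
Qed.

Lemma ge0_integral_subZn_dilate q n (k : q.-tuple int) (f : Rn R q -> \bar R) :
  (0 < n)%N -> measurable_fun setT f -> (forall x, 0 <= f x) ->
  \int[lebesgue_Rn R q]_x f (subZn (dilate n x) k) =
  (n%:R ^+ q)^-1%:E * \int[lebesgue_Rn R q]_x f x.
Proof.
move=> n0; elim: q k f => [k f mf f0|q IH k f mf f0].
  rewrite expr0 invr1 mul1e; apply: eq_integral => x _.
  by congr f; rewrite (tuple0 x) [LHS]tuple0.
have mG := measurable_integral_cons mf f0.
rewrite [RHS]/= !ge0_integral_RnS//; last first.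
  by apply: measurableT_comp => //; exact: measurable_subZn_dilate.
under eq_integral => a _.
  under eq_integral => t _ do rewrite subZn_dilate_cons.
  rewrite (IH _ (fun t => f (consRn (_, t))))//; first over.
  apply: measurableT_comp => //.
  apply: (measurableT_comp (@measurable_consRn R q)).
  by apply: measurable_fun_pair => //; exact: measurable_cst.
have G0 a : 0 <= \int[lebesgue_Rn R q]_t f (consRn (a, t)) by exact: integral_ge0.
have c0 : (0 <= (n%:R ^+ q)^-1 :> R)%R by rewrite invr_ge0 exprn_ge0.
rewrite ge0_integralZl_EFin; last exact: c0.
- rewrite (@ge0_integral_affine _ _ (fun a => \int[lebesgue_Rn R q]_t f (consRn (a, t))))//.
    by rewrite muleA -EFinM -invfM exprSr mulrC.
  by rewrite ltr0n.
- exact: measurableT.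
- by move=> a _; exact: G0.
- by apply: (measurableT_comp mG); exact: measurable_affine.
Qed.

Lemma ge0_integral_prod_Rn q (h : measurableTypeR R -> R) (c : R) :
  measurable_fun setT h -> (forall t, 0 <= h t)%R ->
  \int[@lebesgue_measure R]_t (h t)%:E = c%:E ->
  \int[lebesgue_Rn R q]_x (\prod_(j < q) h (tnth x j))%:E = (c ^+ q)%:E.
Proof.
move=> mh h0 hc; have mP n : measurable_fun setT
    (fun x : Rn R n => (\prod_(j < n) h (tnth x j))%:E).
  apply/measurable_EFinP; apply: measurable_prod => j _.
  by apply: (measurableT_comp mh); exact: measurable_tnth.
have P0 n (x : Rn R n) : 0 <= (\prod_(j < n) h (tnth x j))%:E.
  by rewrite lee_fin prodr_ge0.
elim: q => [|q IH].
  under eq_integral do rewrite big_ord0.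
  by rewrite integral_cst//= diracT mule1 expr0.
rewrite ge0_integral_RnS//.
have prodE a (t : Rn R q) : (\prod_(j < q.+1) h (tnth (consRn (a, t)) j) =
    h a * \prod_(j < q) h (tnth t j))%R.
  rewrite big_ord_recl; congr (_ * _)%R.
  by apply: eq_bigr => j _; rewrite /consRn tnthS.
transitivity (\int[@lebesgue_measure R]_a ((h a)%:E * (c ^+ q)%:E)).
  apply: eq_integral => a _.
  under eq_integral => t _ do rewrite prodE EFinM.
  by rewrite ge0_integralZl_EFin ?IH//; exact: mP.
have c0 : (0 <= c)%R.
  by rewrite -lee_fin -hc; apply: integral_ge0 => t _; rewrite lee_fin.
rewrite ge0_integralZr//.
- by rewrite hc -EFinM exprS.
- exact/measurable_EFinP.
- by move=> t _; rewrite lee_fin.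
- by rewrite lee_fin exprn_ge0.
Qed.

End lebesgue_Rn_integral.

(** * A power weight on the line *)

Section power_decay.
Context {R : realType}.
Local Notation mu := (@lebesgue_measure R).

Lemma powRN_le (s a b : R) : 0 <= s -> 0 < a -> a <= b -> b `^ (- s) <= a `^ (- s).
Proof.
move=> s0 a0 ab; have b0 := lt_le_trans a0 ab.
by rewrite !powRN lef_pV2 ?posrE ?powR_gt0// ge0_ler_powR// nnegrE ltW.
Qed.

Lemma cvg_powRN_y (p : R) : 0 < p -> (1 + t) `^ (- p) @[t --> +oo%R] --> (0 : R).
Proof.
move=> p0; apply/cvgrPdist_lt => e e0; near=> t.
have et : e `^ (- p^-1) < 1 + t.
  by rewrite -ltrBlDl; near: t; exact: nbhs_pinfty_gt.
have t0 : 0 < 1 + t by apply: le_lt_trans et; exact: powR_ge0.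
rewrite sub0r normrN ger0_norm ?powR_ge0//.
rewrite powRN -[ltRHS]invrK ltf_pV2 ?posrE ?powR_gt0 ?invr_gt0//.
have -> : e^-1 = (e `^ (- p^-1)) `^ p.
  by rewrite -powRrM mulNr mulVf ?gt_eqF// powR_inv1// ltW.
by rewrite gt0_ltr_powR// nnegrE ?powR_ge0// ltW.
Unshelve. all: by end_near. Qed.

Lemma is_derive_powR_shift (c p t : R) : 0 < 1 + t ->
  is_derive t 1 (fun u => c * (1 + u) `^ p) (c * (p * (1 + t) `^ (p - 1))).
Proof.
move=> t0; have D1 : is_derive t (1 : R) (shift (1 : R)) 1 by exact: is_derive_shift.
have D2 : is_derive (shift 1 t) 1 (fun u : R => u `^ p) (p * (1 + t) `^ (p - 1)).
  by rewrite [1 + t]addrC; apply: is_derive1_powR; rewrite /= addrC.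
have D3 := is_derive1_comp D2 D1; rewrite mulr1 in D3.
have D4 := is_deriveZ c D3.
rewrite (_ : (fun u => _) = c \*: ((fun u : R => u `^ p) \o shift 1))//.
by apply/funext => u /=; rewrite addrC.
Qed.

Lemma continuous_powR_shift (c p t : R) : 0 < 1 + t ->
  {for t, continuous (fun u : R => c * (1 + u) `^ p)}.
Proof.
move=> t0; apply: differentiable_continuous; apply/derivable1_diffP.
by have [] := is_derive_powR_shift c p t0.
Qed.

Lemma continuous_decay1 (p : R) : continuous (fun t : R => (1 + `|t|) `^ p).
Proof.
move=> t; have t0 : 0 < 1 + `|t| by rewrite ltr_pwDl.
apply: (@continuous_comp _ _ _ (fun t : R => `|t|) (fun u => (1 + u) `^ p)).
  exact: norm_continuous.
rewrite (_ : (fun u => _) = (fun u : R => 1 * (1 + u) `^ p)).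
  exact: continuous_powR_shift.
by apply/funext => u; rewrite mul1r.
Qed.

Lemma integral_decay1 (s : R) : 1 < s ->
  (\int[mu]_t ((1 + `|t|) `^ (- s))%:E = (2 / (s - 1))%:E)%E.
Proof.
move=> s1; have s10 : 0 < s - 1 by rewrite subr_gt0.
rewrite ge0_symfun_integralT; last 3 first.
- by move=> t; exact: powR_ge0.
- exact: continuous_decay1.
- by move=> t /=; rewrite normrN.
pose F t : R := - (s - 1)^-1 * (1 + t) `^ (1 - s).
have dF (t : R) : 0 < 1 + t -> is_derive t 1 F ((1 + t) `^ (- s)).
  move=> t0; have := is_derive_powR_shift (- (s - 1)^-1) (1 - s) t0.
  by rewrite mulrA mulNr -mulrN opprB mulVf ?gt_eqF// mul1r addrAC subrr add0r.
(* [F] is the antiderivative that vanishes at infinity, as [1 - s < 0] *)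
rewrite -set_itvcy (@ge0_continuous_FTC2y _ _ F _ 0).
- by rewrite /F addr0 powR1 mulr1 -EFinB sub0r opprK -EFinM.
- by move=> t _; exact: powR_ge0.
- exact/continuous_subspaceT/continuous_decay1.
- rewrite -[0](mulr0 (- (s - 1)^-1)); apply: cvgM; first exact: cvg_cst.
  by rewrite -opprB; exact: cvg_powRN_y.
- move=> t t0; have t10 : 0 < 1 + t by rewrite ltr_wpDr// ltW.
  by have [] := dF _ t10.
- by apply: cvg_at_right_filter; apply: continuous_powR_shift; rewrite addr0.
- move=> t; rewrite in_itv/= andbT => t0.
  have t10 : 0 < 1 + t by rewrite ltr_wpDr// ltW.
  by rewrite derive1E; have := dF _ t10 => /@derive_val ->; rewrite gtr0_norm.
Qed.

End power_decay.

(** * The L^1 bounds on the kernel and on the operator *)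

Section sampling.
Context {R : realType} {q : nat}.
Local Notation muq := (lebesgue_Rn R q).

Lemma ler_norm_enorm (x : Rn R q) j : `|tnth x j| <= enorm x.
Proof.
rewrite -sqrtr_sqr ler_sqrt ?sumr_ge0// => [|i _]; last exact: sqr_ge0.
by rewrite (bigD1 j)//= lerDl sumr_ge0// => i _; exact: sqr_ge0.
Qed.

(** Since [q s = q + d], the left-hand side is a product of [q] copies of
    [(1 + enorm x)^(- s)], and [|x_j| <= enorm x] bounds the [j]-th of them. *)
Lemma decay_le_prod (x : Rn R q) (d : R) : (0 < q)%N -> 0 < d ->
  (1 + enorm x) `^ (- q%:R - d) <=
  \prod_(j < q) (1 + `|tnth x j|) `^ (- ((q%:R + d) / q%:R)).
Proof.
move=> q_gt0 d0; have q0 : 0 < q%:R :> R by rewrite ltr0n.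
set s := (q%:R + d) / q%:R.
have s0 : 0 <= s by rewrite divr_ge0 ?addr_ge0// ltW.
have -> : - q%:R - d = - s * q%:R.
  by rewrite mulNr divfK ?gt_eqF// opprD.
rewrite powRrM powR_mulrn ?powR_ge0// -[X in _ ^+ X]card_ord -prodr_const.
apply: ler_prod => j _; rewrite powR_ge0/=.
by rewrite powRN_le// ?lerD2l ?ler_norm_enorm// ltr_pwDl.
Qed.

Lemma kernel_L1_fin (xi : Rn R q -> R) : (0 < q)%N -> is_kernel xi ->
  (\int[muq]_x `|xi x|%:E < +oo)%E.
Proof.
move=> q_gt0 [_ _ _ [d [C [d0 C0 xiC]]]].
have q0 : 0 < q%:R :> R by rewrite ltr0n.
pose s : R := (q%:R + d) / q%:R.
have s1 : 1 < s by rewrite ltr_pdivlMr// mul1r ltrDl.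
pose h (t : measurableTypeR R) : R := (1 + `|t|) `^ (- s).
have mh : measurable_fun setT h by exact: continuous_measurable_fun (@continuous_decay1 _ _).
have h0 t : 0 <= h t by exact: powR_ge0.
have hint := ge0_integral_prod_Rn q mh h0 (integral_decay1 s1).
have mprod : measurable_fun setT (fun x : Rn R q => \prod_(j < q) h (tnth x j)).
  apply: measurable_prod => j _.
  by apply: (measurableT_comp mh); exact: measurable_tnth.
have p0 (x : Rn R q) : (0 <= (\prod_(j < q) h (tnth x j))%:E)%E.
  by rewrite lee_fin prodr_ge0.
apply: (@le_lt_trans _ _ (\int[muq]_x (C%:E * (\prod_(j < q) h (tnth x j))%:E))%E).
  apply: ge0_le_integral_nonmeasurable => x; first by rewrite lee_fin.
  rewrite -EFinM lee_fin (le_trans (xiC x))// ler_pM2l//.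
  exact: decay_le_prod.
rewrite ge0_integralZl_EFin//; last 2 first.
- exact/measurable_EFinP.
- exact: ltW.
by rewrite hint -EFinM ltry.
Qed.

Lemma measurable_cell n (k : q.-tuple int) : measurable (cell n k : set (Rn R q)).
Proof.
rewrite (_ : cell n k = [set x : Rn R q | forall j,
   (`[(tnth k j)%:~R / n%:R, ((tnth k j)%:~R + 1) / n%:R[%classic : set R) (tnth x j)]).
  by apply: (@measurable_rect R q (fun j => `[(tnth k j)%:~R / n%:R, ((tnth k j)%:~R + 1) / n%:R[%classic)) => j; exact: measurable_itv.
by apply/seteqP; split => x /= xk j; have := xk j; rewrite /= in_itv.
Qed.

Lemma cell_disjoint n (k l : q.-tuple int) (x : Rn R q) : (0 < n)%N ->
  cell n k x -> cell n l x -> k = l.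
Proof.
move=> n0 xk xl; apply: eq_from_tnth => j.
have n0' : 0 < n%:R :> R by rewrite ltr0n.
have /andP[k1 k2] := xk j; have /andP[l1 l2] := xl j.
have := le_lt_trans k1 l2; have := le_lt_trans l1 k2.
rewrite !ltr_pM2r ?invr_gt0// -[1]/(1%:~R) -!rmorphD/= !ltr_int !ltzD1 => lk kl.
by apply/eqP; rewrite eq_le kl lk.
Qed.

Local Open Scope ereal_scope.

Lemma esum_integral_cell_le n (g : Rn R q -> \bar R) : (0 < n)%N ->
  measurable_fun setT g -> (forall x, 0 <= g x) ->
  \esum_(k in [set: q.-tuple int]) \int[muq]_(x in cell n k) g x
  <= \int[muq]_x g x.
Proof.
move=> n0 mg g0.
under eq_esum do rewrite integral_mkcond.
have E0 k x : 0 <= (g \_ (cell n k)) x by rewrite patchE; case: ifPn.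
rewrite -ge0_integral_esum//; last first.
  move=> k; apply/(measurable_restrictT _ _).1; first exact: measurable_cell.
  exact: measurable_funTS.
apply: ge0_le_integral_nonmeasurable => x; first exact: esum_ge0.
under eq_esum do rewrite patchE.
by apply: esum_indic_disjoint_le => // k l; exact: cell_disjoint.
Qed.

(** The bound is uniform in [n] because the factor [n^q] of the operator
    cancels the Jacobian [n^-q] of the change of variables [y = n x - k]. *)
Lemma sampling_Kantorovich_L1_le (xi g : Rn R q -> R) n : (0 < n)%N ->
  measurable_fun setT xi -> \int[muq]_x `|xi x|%:E < +oo ->
  measurable_fun setT g ->
  'N[muq]_1 [sampling_Kantorovich xi n g] <=
  (\int[muq]_x `|xi x|%:E) * 'N[muq]_1 [EFin \o g].
Proof.
move=> n0 mxi xi_fin mg.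
have n0' : (0 < n%:R ^+ q :> R)%R by rewrite exprn_gt0// ltr0n.
have nq0 := ltW n0'.
have mgE : measurable_fun setT (fun x => `|g x|%:E).
  by apply/measurable_EFinP; exact: measurableT_comp.
have mxiE : measurable_fun setT (fun x => `|xi x|%:E).
  by apply/measurable_EFinP; exact: measurableT_comp.
have xi0 : 0 <= \int[muq]_x `|xi x|%:E by exact: integral_ge0.
have xiE : (fine (\int[muq]_x `|xi x|%:E))%:E = \int[muq]_x `|xi x|%:E.
  by rewrite fineK// ge0_fin_numE.
pose A k := \int[muq]_(u in cell n k) `|g u|%:E.
have A0 k : 0 <= A k by exact: integral_ge0.
have mxik k : measurable_fun setT (fun x : Rn R q => `|xi (subZn (dilate n x) k)|%:E).
  by apply: (measurableT_comp mxiE); exact: measurable_subZn_dilate.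
rewrite !Lnorm1.
have xig x k : 0 <= (n%:R ^+ q)%:E * (A k * `|xi (subZn (dilate n x) k)|%:E).
  by rewrite !mule_ge0.
apply: (@le_trans _ _ (\int[muq]_x \esum_(k in [set: q.-tuple int])
    ((n%:R ^+ q)%:E * (A k * `|xi (subZn (dilate n x) k)|%:E)))).
  apply: ge0_le_integral_nonmeasurable => x //.
  rewrite esumZl// => [|k]; last by rewrite mule_ge0.
  rewrite abseM gee0_abs ?lee_fin//.
  apply: lee_wpmul2l; first by rewrite lee_fin.
  apply: (le_trans (abse_usum_le _)); apply: le_esum => k _.
  rewrite abseM muleC lee_wpmul2r//.
  apply: le_abse_integral; first exact: measurable_cell.
  by apply: measurable_funTS; exact/measurable_EFinP.
rewrite ge0_integral_esum; [|move=> k|by []].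
2: by do 2 (apply: emeasurable_funM; first exact: measurable_cst).
apply: (@le_trans _ _ (\esum_(k in [set: q.-tuple int])
    (fine (\int[muq]_x `|xi x|%:E))%:E * A k)).
  apply: le_esum => k _.
  rewrite ge0_integralZl_EFin; last exact: nq0.
  2: exact: measurableT.
  2: by move=> x _; rewrite mule_ge0.
  2: by apply: emeasurable_funM => //; exact: measurable_cst.
  rewrite ge0_integralZl// (ge0_integral_subZn_dilate k n0 mxiE)//.
  rewrite xiE.
  rewrite muleCA [X in A k * X]muleA -EFinM divff ?gt_eqF// mul1e.
  by rewrite muleC.
rewrite esumZl ?fine_ge0// xiE.
apply: lee_wpmul2l => //.
exact: esum_integral_cell_le.
Qed.

End sampling.

Theorem lemma2 (R : realType) (q : nat) (q_ge1 : (1 <= q)%N)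
    (xi : Rn R q -> R) (xi_kernel : is_kernel xi) :
  exists2 L : R, 0 < L &
  forall (f : Rn R q -> R) (d : measure_display) (Omega : measurableType d)
    (P : probability Omega R) (eps : Omega -> Rn R q -> R),
  (lebesgue_Rn R q).-integrable [set: Rn R q] (EFin \o f) ->
  measurable_fun [set: Omega * Rn R q] (fun p => eps p.1 p.2) ->
  (ereal_sup (range (fun w => \int[lebesgue_Rn R q]_x `|eps w x|%:E))
     < +oo)%E ->
  forall n : nat, (1 <= n)%N ->
  (\int[P]_w 'N[lebesgue_Rn R q]_1 [PSK xi eps n w f]
    <= L%:E * ('N[lebesgue_Rn R q]_1 [EFin \o f]
               + \int[P]_w 'N[lebesgue_Rn R q]_1 [EFin \o eps w]))%E.
Proof.
set muq := lebesgue_Rn R q.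
have I0 : (0 <= \int[muq]_x `|xi x|%:E)%E by exact: integral_ge0.
have mxi := kernel_measurable xi_kernel.
have xi_fin : (\int[muq]_x `|xi x|%:E < +oo)%E by exact: kernel_L1_fin.
have Ifin : (\int[muq]_x `|xi x|%:E \is a fin_num)%E.
  by rewrite ge0_fin_numE.
exists (fine (\int[muq]_x `|xi x|%:E)%E + 1).
  by rewrite ltr_wpDl// fine_ge0.
set L := _ + 1; have L0 : 0 <= L by rewrite addr_ge0// fine_ge0.
move=> f d Omega P eps /integrableP[/measurable_EFinP mf _] meps _ n n1.
have mabs : measurable_fun [set: Omega * Rn R q] (fun p => `|eps p.1 p.2|%:E).
  by apply/measurable_EFinP; exact: measurableT_comp.
have meps1 w : measurable_fun setT (eps w).
  exact: (measurableT_comp meps (measurable_pair1 w)).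
have mN : measurable_fun [set: Omega] (fun w => 'N[muq]_1 [EFin \o eps w])%E.
  rewrite (_ : (fun w => _) =
    fubini_F muq (fun p : Omega * Rn R q => `|eps p.1 p.2|%:E)).
    by apply: measurable_fun_fubini_tonelli_F.
  by apply/funext => w; rewrite Lnorm1.
apply: (@le_trans _ _ (\int[P]_w (L%:E * ('N[muq]_1 [EFin \o f]
    + 'N[muq]_1 [EFin \o eps w])))%E).
  apply: ge0_le_integral_nonmeasurable => w; first exact: Lnorm_ge0.
  apply: (le_trans (sampling_Kantorovich_L1_le n1 mxi xi_fin _)).
    by apply: measurable_funD.
  apply: lee_pmul => //; first exact: Lnorm_ge0.
    by rewrite -[leLHS]fineK// lee_fin lerDl.
  rewrite !Lnorm1 -ge0_integralD//; last 2 first.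
  - by apply/measurable_EFinP; exact: measurableT_comp.
  - by apply/measurable_EFinP; exact: measurableT_comp.
  apply: ge0_le_integral_nonmeasurable => x //.
  by rewrite -EFinD lee_fin ler_normD.
rewrite ge0_integralZl_EFin//; last 2 first.
- by move=> w _; rewrite adde_ge0// Lnorm_ge0.
- by apply: emeasurable_funD => //; exact: measurable_cst.
rewrite ge0_integralD//; last 2 first.
- by move=> w _; exact: Lnorm_ge0.
- by move=> w _; exact: Lnorm_ge0.
have PT : (P [set: Omega] = 1)%E by exact: probability_setT.
by rewrite integral_cst//= PT mule1.
Qed.
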